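(* Let $n \ge 3$ and $m\ge 2$ be integers. Then $$a_1(C_n \,\square\, P_m) = \begin{cases} 2; & (n = 3 \text{ and } 2\le m \le 5), \text{ or } (n = 4 \text{ and } m=2),\\ 3; & (n = 3 \text{ and } m \ge 6), \text{ or } (n = 4 \text{ and } 3 \le m \le 5), \text{ or } (n=5 \text{ and } 2 \le m \le 4),\\ & \text{or } (6 \le n \le 9 \text{ and } m\in\{2,3\}), \text{ or } (n \ge 10 \text{ and } m=2),\\ 4; & \text{otherwise}, \end{cases}$$ and $$a_1'(C_n \,\square\, P_m) = \begin{cases} 2; & n=3,\ m=2,\\ 3; & (n=3 \text{ and } m \ge 3), \text{ or } (n \ge 4 \text{ and } m=2),\\ 4; & n \ge 4,\ m \ge 3. \end{cases}$$
   Context: $C_n$ and $P_n$ are the cycle and the path on $n$ vertices, respectively. The Cartesian product $G\,\square\, H$ of graphs $G$ and $H$ has vertex set $V(G)\times V(H)$, with $(g,h)$ and $(g',h')$ adjacent if either $gg'\in E(G)$ and $h=h'$, or $g=g'$ and $hh'\in E(H)$. A clique of a graph $G$ is an inclusion-wise maximal complete subgraph. The $(a,b)$-monochromatic clique transversal game ($(a,b)$-MCT game) on $G$ is played by Alice and Bob, who alternately take turns: in each of her turns Alice chooses $a$ unplayed vertices and colors them red, and in each of his turns Bob chooses $b$ unplayed vertices and colors them blue (if fewer unplayed vertices remain, the player colors all of them). Alice wins if the red vertices contain at least one vertex of each clique of $G$; Bob wins if all vertices of some clique of $G$ are blue. The game is Alice-start or Bob-start depending on who moves first. The threshold $a_1(G)$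 (resp. $a_1'(G)$) is the smallest positive integer $a$ such that Alice has a winning strategy in the Alice-start (resp. Bob-start) $(a,1)$-MCT game on $G$. *)

(* Defs.v *)
From mathcomp Require Import all_boot.

Set Implicit Arguments.
Unset Strict Implicit.
Unset Printing Implicit Defensive.

(* A simple graph is given by its adjacency relation on a finite type. *)

Definition cycle_adj (n : nat) : rel 'I_n :=
  [rel i j : 'I_n | (j == ordS i) || (i == ordS j)].

Definition path_adj (m : nat) : rel 'I_m :=
  [rel i j : 'I_m | (j == i.+1 :> nat) || (i == j.+1 :> nat)].

Definition cart_prod (T U : finType) (e : rel T) (f : rel U) : rel (T * U) :=
  [rel x y | (e x.1 y.1 && (x.2 == y.2)) || ((x.1 == y.1) && f x.2 y.2)].

Lemma cycle_adj_sym n : symmetric (@cycle_adj n).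
Proof. by move=> i j; rewrite /cycle_adj /= orbC. Qed.

(* For n = 1 the relation has a loop; for n = 2 it is a single edge. *)
Lemma cycle_adj_irr n : 2 < n -> irreflexive (@cycle_adj n).
Proof.
move=> n_gt2 i; rewrite /cycle_adj /= orbb; apply/eqP => /(congr1 val) /= Ei.
have := ltn_ord i; rewrite leq_eqVlt => /orP[/eqP Si | lt_Si].
  by move: Ei; rewrite Si modnn => Ei; move: n_gt2; rewrite -[X in 2 < X]Si Ei.
by move: Ei; rewrite modn_small // => /eqP; rewrite eqn_leq ltnn andbF.
Qed.

Lemma path_adj_sym m : symmetric (@path_adj m).
Proof. by move=> i j; rewrite /path_adj /= orbC. Qed.

Lemma path_adj_irr m : irreflexive (@path_adj m).
Proof. by move=> i; rewrite /path_adj /= orbb eqn_leq ltnn andbF. Qed.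

Definition complete (T : finType) (e : rel T) (A : {set T}) : bool :=
  [forall x in A, forall y in A, (x != y) ==> e x y].

Definition clique (T : finType) (e : rel T) (K : {set T}) : bool :=
  maxset (complete e) K.

(* A position is the pair (red vertices, blue vertices). *)
Definition position (T : finType) : Type := ({set T} * {set T})%type.

Definition unplayed (T : finType) (p : position T) : {set T} :=
  ~: (p.1 :|: p.2).

(* Strategies depend on the position only: no unfinished position recurs within
   a play, so depending on the history would not change who can win. *)
Definition strategy (T : finType) : Type := position T -> {set T}.

Definition legal (T : finType) (k : nat) (s : strategy T) : Prop :=
  forall p, s p \subset unplayed p /\ #|s p| = minn k #|unplayed p|.

Inductive player : Set := Alice | Bob.

Definition alice_turn (T : finType) (s : strategy T) (p : position T) :
    position T :=
  (p.1 :|: s p, p.2).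

Definition bob_turn (T : finType) (s : strategy T) (p : position T) :
    position T :=
  (p.1, p.2 :|: s p).

Definition round (T : finType) (first : player) (sA sB : strategy T)
    (p : position T) : position T :=
  match first with
  | Alice => bob_turn sB (alice_turn sA p)
  | Bob => alice_turn sA (bob_turn sB p)
  end.

(* For positive quotas, every vertex has been colored after #|T| rounds.
   Playing on once the winner is known does not change the winner. *)
Definition final_position (T : finType) (first : player)
    (sA sB : strategy T) : position T :=
  iter #|T| (round first sA sB) (set0, set0).

Definition alice_won (T : finType) (e : rel T) (p : position T) : Prop :=
  forall K, clique e K -> exists2 x, x \in K & x \in p.1.

Definition bob_won (T : finType) (e : rel T) (p : position T) : Prop :=
  exists2 K, clique e K & K \subset p.2.

Lemma alice_turn_unplayed (T : finType) (k : nat) (s : strategy T)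
    (p : position T) :
  legal k s -> [disjoint p.1 & p.2] ->
  [disjoint (alice_turn s p).1 & (alice_turn s p).2] /\
  #|unplayed (alice_turn s p)| = #|unplayed p| - k.
Proof.
case: p => R B /(_ (R, B)) [sub card] /= dRB; split.
  rewrite -setI_eq0 setIUl setU_eq0 !setI_eq0 dRB /=.
  rewrite disjoints_subset (subset_trans sub) //.
  by rewrite /unplayed /= setCU subsetIr.
have -> : unplayed (alice_turn s (R, B)) = unplayed (R, B) :\: s (R, B).
  by rewrite /unplayed /= setDE -setCU setUAC.
by rewrite cardsD (setIidPr sub) card; case: leqP => // /ltnW /eqP ->;
  rewrite subnn.
Qed.

Lemma bob_turn_unplayed (T : finType) (k : nat) (s : strategy T)
    (p : position T) :
  legal k s -> [disjoint p.1 & p.2] ->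
  [disjoint (bob_turn s p).1 & (bob_turn s p).2] /\
  #|unplayed (bob_turn s p)| = #|unplayed p| - k.
Proof.
case: p => R B /(_ (R, B)) [sub card] /= dRB; split.
  rewrite -setI_eq0 setIUr setU_eq0 !setI_eq0 dRB /= disjoint_sym.
  rewrite disjoints_subset (subset_trans sub) //.
  by rewrite /unplayed /= setCU subsetIl.
have -> : unplayed (bob_turn s (R, B)) = unplayed (R, B) :\: s (R, B).
  by rewrite /unplayed /= setDE -setCU setUA.
by rewrite cardsD (setIidPr sub) card; case: leqP => // /ltnW /eqP ->;
  rewrite subnn.
Qed.

Lemma final_positionP (T : finType) first a b (sA sB : strategy T) :
  0 < a -> legal a sA -> legal b sB ->
  let p := final_position first sA sB in p.2 = ~: p.1.
Proof.
move=> a_gt0 lA lB /=; rewrite /final_position.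
suff H k : let p := iter k (round first sA sB) (set0, set0) in
    [disjoint p.1 & p.2] /\ #|unplayed p| <= #|T| - k.
  have [/=] := H #|T|; set p := iter _ _ _.
  rewrite subnn leqn0 cards_eq0 /unplayed setCU => dp /eqP up.
  apply/eqP; rewrite eqEsubset -disjoints_subset disjoint_sym dp /=.
  by rewrite -[p.2]setCK -disjoints_subset -setI_eq0 up.
elim: k => [|k [/=]]; first by rewrite /= disjoints_subset sub0set subn0 max_card.
move: (iter _ _ _) => p dp up; rewrite /round; case: first.
  have [dA uA] := alice_turn_unplayed lA dp.
  have [dB uB] := bob_turn_unplayed lB dA.
  split=> //; rewrite uB uA (leq_trans (leq_subr _ _)) // subnS.
  by rewrite -subn1 leq_sub.
have [dB uB] := bob_turn_unplayed lB dp.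
have [dA uA] := alice_turn_unplayed lA dB.
split=> //; rewrite uA uB subnS -subn1 leq_sub //.
exact: leq_trans (leq_subr _ _) up.
Qed.

Lemma final_outcome (T : finType) (e : rel T) first a b (sA sB : strategy T) :
  0 < a -> legal a sA -> legal b sB ->
  let p := final_position first sA sB in alice_won e p <-> ~ bob_won e p.
Proof.
move=> a_gt0 lA lB p; have Ep : p.2 = ~: p.1 := final_positionP first a_gt0 lA lB.
split=> [wA [K cK] | nB K cK].
  rewrite Ep => /subsetP sK; have [x xK xR] := wA K cK.
  by have := sK x xK; rewrite inE xR.
have /subsetPn[x xK] : ~~ (K \subset p.2) by apply/negP => sK; case: nB; exists K.
by rewrite Ep inE negbK; exists x.
Qed.

Definition alice_wins_MCT (T : finType) (e : rel T) (first : player)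
    (a b : nat) : Prop :=
  exists2 sA : strategy T, legal a sA &
    forall sB, legal b sB -> alice_won e (final_position first sA sB).

(* The threshold is a relation rather than a function because in the Bob-start
   game on a graph with an isolated vertex no such integer exists. *)
Definition is_threshold (T : finType) (e : rel T) (first : player)
    (a : nat) : Prop :=
  [/\ 0 < a, alice_wins_MCT e first a 1
    & forall a', 0 < a' -> alice_wins_MCT e first a' 1 -> a <= a'].

Definition is_a1 (T : finType) (e : rel T) (a : nat) : Prop :=
  is_threshold e Alice a.

Definition is_a1' (T : finType) (e : rel T) (a : nat) : Prop :=
  is_threshold e Bob a.

(* Main.v *)
(** For n >= 4 every clique of C_n x P_m is an edge. If Bob colors a vertex all
    of whose neighbours are unplayed and there are more than [a] of them, Alice
    cannot answer; conversely, if every unplayed vertex has at most [a] unplayed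
    neighbours, Alice survives by coloring the whole neighbourhood of each vertex
    Bob plays. So Bob-start is decided by the maximum degree, and Alice-start by
    whether her first [a] vertices can bring all these degrees down to [a].
    If a row r is dominated by a set with k_j vertices in row j, then
    n <= 3 k_r + k_(r-1) + k_(r+1); whenever Bob should win, these inequalities
    for a few rows r contradict sum k_j <= a.

    For n = 3 the cliques are the triangles (the rows) and the path edges. Bob
    wins when some row and two of its columns in the adjacent rows are free of
    red: he colors one of the two columns, Alice has to spend her whole turn on
    its path neighbours, and the second column threatens its path neighbours and
    the triangle at once. Alice keeps all rows safe as soon as each row without
    red has at most one column with [a] path neighbours not yet red. *)

Require Import Defs.
From mathcomp Require Import all_boot.
From mathcomp Require Import zify.

Set Implicit Arguments.
Unset Strict Implicit.
Unset Printing Implicit Defensive.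

(** * Playing with invariants *)

Lemma superset_of_card (T : finType) (A U : {set T}) k :
  A \subset U -> #|A| <= k <= #|U| ->
  exists B : {set T}, [/\ A \subset B, B \subset U & #|B| = k].
Proof.
move=> sAU /andP[]; elim: k => [|k IH] Ak kU.
  by exists A; split=> //; apply/eqP; rewrite -leqn0.
move: Ak; rewrite leq_eqVlt ltnS => /orP[/eqP EA|Ak].
  by exists A.
have [B [sAB sBU EB]] := IH Ak (ltnW kU).
have /subsetPn[x xU xB] : ~~ (U \subset B).
  by apply/negP => /subset_leq_card; rewrite EB leqNgt kU.
exists (x |: B); split; last by rewrite cardsU1 xB EB.
  exact: subset_trans sAB (subsetU1 _ _).
by rewrite subUset sub1set xU.
Qed.

Section Game.
Variables (T : finType) (e : rel T).
Implicit Types (p : position T) (v w x y : T) (A B K R S : {set T}).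

Lemma in_unplayed p x : (x \in unplayed p) = (x \notin p.1) && (x \notin p.2).
Proof. by rewrite !inE negb_or. Qed.

Definition legal_move k p A :=
  (A \subset unplayed p) && (#|A| == minn k #|unplayed p|).

(** The strategies below are designed with at most [k] vertices, while a legal move has exactly the
    prescribed size; the difference is padded arbitrarily. *)
Lemma legal_move_extend k p A : A \subset unplayed p -> #|A| <= k ->
  exists2 B, legal_move k p B & A \subset B.
Proof.
move=> sA Ak.
have [|B [sAB sBU EB]] := @superset_of_card _ A (unplayed p)
  (minn k #|unplayed p|) sA; last by exists B; rewrite // /legal_move sBU EB /=.
by rewrite leq_min Ak subset_leq_card // geq_minr.
Qed.

(** [legal] constrains a strategy in every position, reachable or not, so any legal move serves as
    fallback. The default [set0] is never reached, since a legal move always exists. *)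
Definition prefer k (P : position T -> pred {set T}) : strategy T := fun p =>
  if [pick A | legal_move k p A && P p A] is Some A then A
  else odflt set0 [pick A | legal_move k p A].

Lemma prefer_legal k P : legal k (prefer k P).
Proof.
move=> p; rewrite /prefer; case: pickP => [A /andP[/andP[-> /eqP ->]] //|_].
case: pickP => [A /andP[-> /eqP ->] //|no].
by have [||B] := @legal_move_extend k p set0; rewrite ?sub0set ?cards0 ?no.
Qed.

Lemma preferP k (P : position T -> pred {set T}) p A :
  legal_move k p A -> P p A -> P p (prefer k P p).
Proof.
move=> lA PA; rewrite /prefer; case: pickP => [B /andP[] //|/(_ A)].
by rewrite lA PA.
Qed.

Lemma bob_move (sB : strategy T) p : legal 1 sB ->
  unplayed p = set0 /\ bob_turn sB p = p \/
  exists2 v, v \in unplayed p & bob_turn sB p = (p.1, p.2 :|: [set v]).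
Proof.
move=> /(_ p)[sub]; have [E0 /esym/eqP|/set0Pn[u uU]] := eqVneq (unplayed p) set0.
  rewrite E0 cards0 minn0 eq_sym cards_eq0 => /eqP Es; left; split=> //.
  by rewrite /bob_turn Es setU0 -surjective_pairing.
have /minn_idPl-> : 0 < #|unplayed p| by rewrite card_gt0; apply/set0Pn; exists u.
move/eqP/cards1P=> [v Ev]; right; exists v; last by rewrite /bob_turn Ev.
by rewrite Ev sub1set in sub.
Qed.

(** * Winning for Alice by an invariant *)

Section AliceInvariant.
Variables (a : nat) (J : pred (position T)).
Hypothesis J_step : forall p v, J p -> v \in unplayed p -> exists A,
  [/\ A \subset unplayed (p.1, p.2 :|: [set v]), #|A| <= a
    & J (p.1 :|: A, p.2 :|: [set v])].
Hypothesis J_mono : forall p A, J p -> A \subset unplayed p -> J (p.1 :|: A, p.2).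
Hypothesis J_end : forall p, J p -> unplayed p = set0 -> alice_won e p.

(** [J] is meant for positions with Bob to move; [good] is its counterpart with Alice to move. *)
Let good p := exists A, [/\ A \subset unplayed p, #|A| <= a & J (p.1 :|: A, p.2)].
Let sA := prefer a (fun p A => J (p.1 :|: A, p.2)).

Let good_bob (sB : strategy T) p : legal 1 sB -> J p -> good (bob_turn sB p).
Proof.
move=> lB Jp; case: (bob_move p lB) => [[_ ->]|[v vU ->]]; last exact: J_step.
by exists set0; rewrite sub0set cards0 setU0 -surjective_pairing.
Qed.

(** The intended answer is padded to a legal move, and [J_mono] absorbs the additional red
    vertices. *)
Let good_alice p : good p -> J (alice_turn sA p).
Proof.
case=> A [sAU Aa JA]; have [B lB sAB] := legal_move_extend sAU Aa.
apply: (@preferP a (fun p A => J (p.1 :|: A, p.2)) p B) => //.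
rewrite -(setUidPr sAB).
have := @J_mono (p.1 :|: A, p.2) (B :\: A) JA.
rewrite /= -setUA setDE setUIr setUCr setIT; apply; apply/subsetP => x.
case/andP: lB => /subsetP sB _.
rewrite in_setI in_setC => /andP[/sB]; rewrite !in_unplayed in_setU negb_or.
by case/andP=> -> -> ->.
Qed.

Let full (sB : strategy T) f : 0 < a -> legal 1 sB ->
  unplayed (final_position f sA sB) = set0.
Proof.
move=> a0 lB; rewrite /unplayed (final_positionP f a0 (prefer_legal _ _) lB).
by rewrite setUCr setCT.
Qed.

Lemma alice_wins_bob_start : 0 < a -> J (set0, set0) ->
  alice_wins_MCT e Bob a 1.
Proof.
move=> a0 J0; exists sA; first exact: prefer_legal.
move=> sB lB; apply: J_end; last exact: full.
rewrite /final_position; elim: #|T| => // k IH; rewrite iterS.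
exact/good_alice/good_bob.
Qed.

(** Rounds start with Alice, so [good] is carried through them, with [S] as the first answer. On the
    full board her answer is empty, which turns [good] into [J]. *)
Lemma alice_wins_alice_start S : 0 < a -> #|S| <= a -> J (S, set0) ->
  alice_wins_MCT e Alice a 1.
Proof.
move=> a0 Sa J0; exists sA; first exact: prefer_legal.
move=> sB lB; have := full Alice a0 lB; set p := final_position _ _ _ => fp.
suff [A [sAU _ JA]] : good p.
  move: sAU JA; rewrite fp subset0 => /eqP ->.
  by rewrite setU0 -surjective_pairing => /J_end; apply.
rewrite /p /final_position; elim: #|T| => [|k IH]; last first.
  by rewrite iterS; apply/good_bob/good_alice.
exists S; rewrite set0U; split=> //.
by rewrite /unplayed setU0 setC0 subsetT.
Qed.

End AliceInvariant.

(** * Winning for Bob in boundedly many moves *)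

Definition blue_clique p := [exists K, clique e K && (K \subset p.2)].

(** Bob is to move and needs at most [k] further moves. Alice may answer with any set of at most [a]
    unplayed vertices, which covers all legal answers, also on a nearly full board. *)
Fixpoint bob_win a k p : bool :=
  blue_clique p || if k is k'.+1 then
    [exists v in unplayed p, [forall A : {set T},
      (A \subset unplayed (p.1, p.2 :|: [set v])) && (#|A| <= a) ==>
      bob_win a k' (p.1 :|: A, p.2 :|: [set v])]]
  else false.

Lemma bob_win_blue a k p : blue_clique p -> bob_win a k p.
Proof. by case: k => /= [|k] ->. Qed.

Section BobWins.
Variables (a N : nat) (sA : strategy T).
Hypotheses (a_gt0 : 0 < a) (sA_legal : legal a sA).

(** Bob's invariant. The bound [N] on the number of moves makes the existential quantifier boolean,
    as [prefer] requires. *)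
Let Q p := [exists k : 'I_N.+1, bob_win a k p].
Let PB p (B : {set T}) := let q := (p.1, p.2 :|: B) in
  [forall A : {set T}, (A \subset unplayed q) && (#|A| <= a) ==>
    Q (p.1 :|: A, p.2 :|: B)].
Let sB := prefer 1 PB.

Let sB_step p : Q p -> Q (alice_turn sA (bob_turn sB p)).
Proof.
move=> Qp.
suff /forallP/(_ (sA (bob_turn sB p)))/implyP : PB p (sB p).
  apply; have [-> ->] := sA_legal (bob_turn sB p).
  exact: geq_minl.
case/existsP: Qp => -[k kN] /= w.
have [/existsP[K /andP[cK sK]]|nblue] := boolP (blue_clique p).
  (* A blue clique stays blue, so any move of Bob will do and no further one is needed. *)
  apply/forallP => A; apply/implyP => _; apply/existsP; exists ord0.
  apply/bob_win_blue/existsP; exists K; rewrite cK /=.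
  exact: subset_trans sK (subsetUl _ _).
case: k kN w => [|k] kN /=; rewrite (negPf nblue) //=.
case/existsP=> v /andP[vU /forallP H]; apply: (@preferP _ PB p [set v]).
  rewrite /legal_move sub1set vU cards1 eq_sym; apply/eqP/minn_idPl.
  by rewrite card_gt0; apply/set0Pn; exists v.
apply/forallP => A; apply/implyP => hA; have /implyP/(_ hA) {}H := H A.
by apply/existsP; exists (Ordinal (ltnW kN)).
Qed.

(** On a full board the recursive branch of [bob_win] has no vertex to offer, so a blue clique is
    present. *)
Let sB_end p : Q p -> p.2 = ~: p.1 -> ~ alice_won e p.
Proof.
case/existsP=> -[k _] /= w E.
have [/existsP[K /andP[cK sK]] /(_ K cK)[x xK xR]|nblue] := boolP (blue_clique p).
  by have := subsetP sK x xK; rewrite E inE xR.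
case: k w => [|k] /=; rewrite (negPf nblue) //= => /existsP[v].
by rewrite in_unplayed E inE; case: (v \in p.1).
Qed.

Let sB_legal : legal 1 sB := @prefer_legal 1 PB.

Lemma bob_wins_bob_start_against : bob_win a N (set0, set0) ->
  exists2 s, legal 1 s & ~ alice_won e (final_position Bob sA s).
Proof.
move=> w; exists sB => //; apply: sB_end; last exact: final_positionP sA_legal _.
rewrite /final_position; elim: #|T| => [|k IH].
  by apply/existsP; exists ord_max.
by rewrite iterS; apply: sB_step.
Qed.

Lemma bob_wins_alice_start_against :
  (forall S, #|S| <= a -> bob_win a N (S, set0)) ->
  exists2 s, legal 1 s & ~ alice_won e (final_position Alice sA s).
Proof.
move=> w; exists sB => //; have := final_positionP Alice a_gt0 sA_legal sB_legal.
set p := final_position _ _ _ => /= E; apply: sB_end => //.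
(* The board is full, so another turn of Alice changes nothing. This shifts the play by half a
   round, to positions with Bob to move, where [Q] applies. *)
have -> : p = alice_turn sA p.
  have [+ _] := sA_legal p; rewrite /unplayed /alice_turn E setUCr setCT subset0.
  by move/eqP->; rewrite setU0 -E -surjective_pairing.
rewrite /p /final_position; elim: #|T| => [|k IH]; last first.
  by rewrite iterS; apply: sB_step.
apply/existsP; exists ord_max; rewrite /alice_turn set0U; apply: w.
by have [_ ->] := sA_legal (set0, set0); apply: geq_minl.
Qed.

End BobWins.

Lemma bob_start_lost a N : 0 < a -> bob_win a N (set0, set0) ->
  ~ alice_wins_MCT e Bob a 1.
Proof.
move=> a0 w [sA lA]; have [s ls] := bob_wins_bob_start_against a0 lA w.
by move=> + /(_ s ls).
Qed.

Lemma alice_start_lost a N : 0 < a ->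
  (forall S, #|S| <= a -> bob_win a N (S, set0)) -> ~ alice_wins_MCT e Alice a 1.
Proof.
move=> a0 w [sA lA]; have [s ls] := bob_wins_alice_start_against a0 lA w.
by move=> + /(_ s ls).
Qed.

Lemma bob_win_step a k p v : v \in unplayed p ->
  (forall A, A \subset unplayed (p.1, p.2 :|: [set v]) -> #|A| <= a ->
    bob_win a k (p.1 :|: A, p.2 :|: [set v])) -> bob_win a k.+1 p.
Proof.
move=> vU H; apply/orP; right; apply/existsP; exists v; rewrite vU.
by apply/forallP => A; apply/implyP => /andP[]; apply: H.
Qed.

Lemma bob_win_now a k p v K : v \in unplayed p -> clique e K ->
  K \subset p.2 :|: [set v] -> bob_win a k.+1 p.
Proof.
move=> vU cK sK; apply: (bob_win_step vU) => A _ _.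
by apply/bob_win_blue/existsP; exists K; rewrite cK.
Qed.

(** After [v], every vertex of [W] completes a blue clique, and Alice cannot color all of [W] in one
    turn. *)
Lemma bob_win_fork a p v (W : {set T}) : v \in unplayed p ->
  W \subset unplayed p :\ v -> a < #|W| ->
  (forall w, w \in W -> exists2 K, clique e K & K \subset p.2 :|: [set v; w]) ->
  bob_win a 2 p.
Proof.
move=> vU /subsetP sW aW HW; apply: (bob_win_step vU) => A _ Aa.
have /subsetPn[w wW wA] : ~~ (W \subset A).
  by apply/negP => /subset_leq_card; rewrite leqNgt (leq_ltn_trans Aa).
have [K cK sK] := HW w wW; apply: (@bob_win_now a 0 _ w K) => //.
  have := sW w wW; rewrite !inE /= !negb_or => /andP[-> /andP[-> ->]].
  by rewrite wA.
by rewrite -setUA.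
Qed.

(** * Cliques and edges *)

Lemma clique_intro K : complete e K ->
  (forall z, z \notin K -> exists2 x, x \in K & ~~ e x z) -> clique e K.
Proof.
move=> cK max; apply/maxsetP; split=> // B /forall_inP cB sKB; apply/eqP.
rewrite eqEsubset sKB andbT; apply/subsetP => z zB; apply: contraT => zK.
have [x xK] := max z zK.
have /forall_inP/(_ z zB)/implyP-> // := cB x (subsetP sKB x xK).
by apply: contraNneq zK => <-.
Qed.

Hypotheses (e_sym : symmetric e) (e_irr : irreflexive e).

Lemma complete_edge x y : e x y -> complete e [set x; y].
Proof.
move=> xy; apply/forall_inP => u; rewrite !inE => /orP[]/eqP->;
  apply/forall_inP => v; rewrite !inE => /orP[]/eqP->;
  by rewrite ?eqxx // ?xy ?implybT // e_sym xy implybT.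
Qed.

Lemma clique_edge x y : e x y -> (forall z, ~~ (e x z && e y z)) ->
  clique e [set x; y].
Proof.
move=> xy tri; apply: clique_intro; first exact: complete_edge.
move=> z _; have := tri z; rewrite negb_and => /orP[nz|nz].
  by exists x; rewrite ?set21.
by exists y; rewrite ?set22.
Qed.

(** The empty set and singletons are not maximal: without isolated vertices each lies inside an
    edge. *)
Lemma clique_has_edge K x0 : (forall x, exists y, e x y) -> clique e K ->
  exists x y, [/\ x \in K, y \in K & e x y].
Proof.
move=> noiso /maxsetP[/forall_inP cK maxK].
have [x xK] : exists x, x \in K.
  apply/set0Pn/negP => /eqP K0; have [y xy] := noiso x0.
  have := maxK _ (complete_edge xy); rewrite K0 => /(_ (sub0set _)) /setP/(_ x0).
  by rewrite !inE eqxx.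
have [y xy] := noiso x.
have [/existsP[z /andP[zK zx]]|] := boolP [exists z in K, z != x].
  exists x, z; split=> //; have /forall_inP/(_ z zK)/implyP := cK x xK.
  by rewrite eq_sym; apply.
rewrite negb_exists => /forallP K1; have sub : K \subset [set x; y].
  apply/subsetP => z zK; have := K1 z; rewrite zK /= negbK => /eqP->.
  exact: set21.
by exists x, y; rewrite -(maxK _ (complete_edge xy) sub) set21 set22.
Qed.

(* Once every unplayed vertex has at most [a] unplayed neighbours, Alice
   can always answer Bob by coloring the whole neighbourhood of his vertex. *)
Section Degree.
Variables (a : nat) (x0 : T).
Hypotheses (a_gt0 : 0 < a) (noiso : forall x, exists y, e x y).

Let J : pred (position T) := fun p =>
  [forall x in p.2, forall y, e x y ==> (y \in p.1)] &&
  [forall x in unplayed p, #|[set y in unplayed p | e x y]| <= a].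

Let J_step p v : J p -> v \in unplayed p -> exists A,
  [/\ A \subset unplayed (p.1, p.2 :|: [set v]), #|A| <= a
    & J (p.1 :|: A, p.2 :|: [set v])].
Proof.
case/andP=> /forall_inP HB /forall_inP HU vU.
exists [set y in unplayed p | e v y]; split; last 1 first.
- apply/andP; split; apply/forall_inP => x.
    rewrite /= !inE => /orP[xB|/eqP->]; apply/forallP => y; apply/implyP => xy.
      by have /forallP/(_ y)/implyP/(_ xy) yR := HB x xB; rewrite inE yR.
    (* A blue neighbour of [v] would have forced [v] to be red. *)
    rewrite !inE xy andbT; case: (boolP (y \in p.1)) => //= _; apply/negP => yB.
    have /forallP/(_ v) := HB y yB; rewrite e_sym xy /=.
    by move: vU; rewrite in_unplayed => /andP[/negPf->].
  rewrite in_unplayed !inE !negb_or => /andP[/andP[xR _]/andP[xB _]].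
  apply: leq_trans (HU x _); last by rewrite in_unplayed xR.
  apply/subset_leq_card/subsetP => y; rewrite !inE !negb_or.
  by case/andP=> /andP[/andP[-> _]/andP[-> _]] ->.
- apply/subsetP => y; rewrite !inE !negb_or => /andP[/andP[-> ->] vy] /=.
  by apply: contraTneq vy => ->; rewrite e_irr.
- exact: HU.
Qed.

Let J_mono p A : J p -> A \subset unplayed p -> J (p.1 :|: A, p.2).
Proof.
case/andP=> /forall_inP HB /forall_inP HU _; apply/andP; split.
  apply/forall_inP => x /HB/forallP H; apply/forallP => y.
  by apply/implyP => xy; have /implyP/(_ xy) yR := H y; rewrite inE yR.
apply/forall_inP => x; rewrite in_unplayed inE negb_or => /andP[/andP[xR _] xB].
apply: leq_trans (HU x _); last by rewrite in_unplayed xR.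
apply/subset_leq_card/subsetP => y; rewrite !inE !negb_or.
by case/andP=> /andP[/andP[-> _] ->] ->.
Qed.

Let J_end p : J p -> unplayed p = set0 -> alice_won e p.
Proof.
case/andP=> /forall_inP HB _ U0 K /(clique_has_edge x0 noiso)[x [y [xK yK xy]]].
have /setP/(_ x) := U0; rewrite in_unplayed inE => /negbT.
rewrite negb_and !negbK => /orP[xR|xB]; first by exists x.
by exists y => //; have /forallP/(_ y) := HB x xB; rewrite xy.
Qed.

Lemma alice_degree_bob_start : (forall x, #|[set y | e x y]| <= a) ->
  alice_wins_MCT e Bob a 1.
Proof.
move=> deg; apply: (alice_wins_bob_start J_step J_mono J_end) => //.
apply/andP; split; apply/forall_inP => x; first by rewrite inE.
move=> _; apply: leq_trans (deg x); apply/subset_leq_card/subsetP => y.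
by rewrite !inE => /andP[].
Qed.

(** One red neighbour removes an excess of one over [a], which is all that the openings below
    require. *)
Lemma alice_degree_alice_start S : #|S| <= a ->
  (forall x, [\/ x \in S, #|[set y | e x y]| <= a
    | #|[set y | e x y]| <= a.+1 /\ exists2 y, y \in S & e x y]) ->
  alice_wins_MCT e Alice a 1.
Proof.
move=> Sa deg; apply: (alice_wins_alice_start J_step J_mono J_end (S := S)) => //.
apply/andP; split; apply/forall_inP => x; first by rewrite inE.
rewrite in_unplayed /= => /andP[xS _].
have sub : [set y in unplayed (S, set0) | e x y] \subset [set y | e x y].
  by apply/subsetP => y; rewrite !inE => /andP[].
have [xS'|dx|[dx [y yS xy]]] := deg x; first by rewrite xS' in xS.
  exact: leq_trans (subset_leq_card sub) dx.
rewrite -ltnS; apply: leq_trans dx; apply: proper_card.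
by rewrite properE sub; apply/subsetPn; exists y; rewrite !inE ?yS.
Qed.

End Degree.

(** The fork at [x] uses all its neighbours at once: each is unplayed and forms a clique with
    [x]. *)
Lemma bob_win_undominated a S x :
  (forall u v, e u v -> clique e [set u; v]) ->
  x \notin S -> (forall y, y \in S -> ~~ e x y) -> a < #|[set y | e x y]| ->
  bob_win a 2 (S, set0).
Proof.
move=> edgeK xS nS ax; apply: (@bob_win_fork a (S, set0) x _ _ _ ax).
- by rewrite in_unplayed xS inE.
- apply/subsetP => y; rewrite !inE orbF => xy; apply/andP; split.
    by apply: contraTneq xy => ->; rewrite e_irr.
  by apply: contraL xy; apply: nS.
- by move=> w; rewrite inE => xw; exists [set x; w]; rewrite ?subsetUr //; apply: edgeK.
Qed.

End Game.

(** * The grid C_n x P_m *)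

(** Turns the successor modulo [n] into conditions that [lia] can handle. *)
Lemma eq_ordS n (k l : 'I_n) : (l == ordS k) =
  (l == k.+1 :> nat) || (l == 0 :> nat) && (k.+1 == n).
Proof.
rewrite -val_eqE /=; have := ltn_ord k; have := ltn_ord l.
rewrite [k < n]leq_eqVlt => + /orP[/eqP Ek|lt_k]; last by rewrite modn_small; lia.
by rewrite Ek modnn; lia.
Qed.

Lemma cycle_adjE n (i j : 'I_n) : cycle_adj i j =
  [|| j == i.+1 :> nat, i == j.+1 :> nat,
      (i == 0 :> nat) && (j.+1 == n) | (j == 0 :> nat) && (i.+1 == n)].
Proof. by rewrite /cycle_adj /= !eq_ordS; lia. Qed.

Lemma card_path_nbr m (r : 'I_m) :
  #|[set j | path_adj r j]| = (0 < r) + (r.+1 < m).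
Proof.
have -> : [set j | path_adj r j] =
    [set j : 'I_m | j == r.+1 :> nat] :|: [set j : 'I_m | r == j.+1 :> nat].
  by apply/setP => j; rewrite !inE.
rewrite cardsU [X in _ - X]eq_card0; last by move=> j; rewrite !inE; lia.
rewrite subn0 addnC; congr addn.
  case: r => -[|r] rm /=; first by apply: eq_card0 => j; rewrite !inE.
  rewrite (_ : [set _ | _] = [set Ordinal (ltnW rm)]) ?cards1 //.
  by apply/setP => j; rewrite !inE eqSS eq_sym.
case: ltnP => [rm|mr].
  rewrite (_ : [set _ | _] = [set Ordinal rm]) ?cards1 //.
  by apply/setP => j; rewrite !inE.
by apply: eq_card0 => j; rewrite !inE; have := ltn_ord j; lia.
Qed.

Section Grid.
Variables n m : nat.
Hypothesis n_ge3 : 2 < n.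
Local Notation V := ('I_n * 'I_m)%type.
Local Notation G := (cart_prod (@cycle_adj n) (@path_adj m)).
Implicit Types (x y z : V) (S : {set V}).

(** Path edges are kept apart because they are always cliques, whereas for n = 3 a cycle edge lies
    in a triangle. *)
Definition vert_adj : rel V := [rel x y | (x.1 == y.1) && path_adj x.2 y.2].

Lemma grid_sym : symmetric G.
Proof.
move=> x y; rewrite /cart_prod /= cycle_adj_sym path_adj_sym.
by rewrite [x.2 == _]eq_sym [x.1 == _]eq_sym.
Qed.

Lemma grid_irr : irreflexive G.
Proof. by move=> x; rewrite /cart_prod /= cycle_adj_irr // path_adj_irr andbF. Qed.

Lemma gridE x y : G x y = (cycle_adj x.1 y.1 && (x.2 == y.2)) || vert_adj x y.
Proof. by []. Qed.

Lemma vert_adj_sym : symmetric vert_adj.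
Proof. by move=> x y; rewrite /vert_adj /= path_adj_sym eq_sym. Qed.

Lemma card_vert_nbr x :
  #|[set y | vert_adj x y]| = (0 < x.2) + (x.2.+1 < m).
Proof.
rewrite -card_path_nbr -[RHS](card_imset _ (_ : injective (pair x.1)));
  last by move=> ? ? [].
apply: eq_card => -[i j]; rewrite !inE /vert_adj /=.
apply/andP/imsetP => [[/eqP <- xj]|[k]]; first by exists j; rewrite ?inE.
by rewrite inE => xk [-> ->].
Qed.

Lemma card_cycle_nbr (i : 'I_n) : #|[set j | cycle_adj i j]| = 2.
Proof.
have -> : [set j | cycle_adj i j] = [set ordS i; ord_pred i].
  apply/setP => j; rewrite !inE /cycle_adj /=; congr orb.
  by apply/eqP/eqP => ->; rewrite ?ordSK ?ord_predK.
(* If successor and predecessor of [i] agreed, two steps forward would lead back to [i], which is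
   impossible for n > 2. *)
rewrite cards2 (_ : _ != _) //; apply/eqP => /(congr1 (@ordS n)).
have [j Ej] : exists j, j == ordS i by exists (ordS i).
rewrite ord_predK -(eqP Ej) => /esym/eqP; move: Ej.
rewrite !eq_ordS; have := ltn_ord i; lia.
Qed.

Lemma card_grid_nbr x :
  #|[set y | G x y]| = 2 + ((0 < x.2) + (x.2.+1 < m)).
Proof.
rewrite -card_vert_nbr -(card_cycle_nbr x.1).
rewrite -[X in _ = X + _](card_imset _ (_ : injective (fun j => (j, x.2))));
  last by move=> ? ? [].
rewrite (_ : [set y | G x y] =
  [set (j, x.2) | j in [set j | cycle_adj x.1 j]] :|: [set y | vert_adj x y]).
  rewrite cardsU [X in _ - X]eq_card0 ?subn0 // => y.
  rewrite in_setI; apply/negbTE/andP => -[/imsetP[j _ ->]].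
  by rewrite inE /vert_adj /= path_adj_irr andbF.
apply/setP => -[i j]; rewrite !inE; congr orb.
apply/andP/imsetP => /= [[xi /eqP->]|[k]]; first by exists i; rewrite ?inE.
by rewrite inE => ? [-> ->].
Qed.

Lemma grid_no_isolated x : exists y, G x y.
Proof.
have /card_gt0P[y] : 0 < #|[set y | G x y]| by rewrite card_grid_nbr.
by rewrite inE; exists y.
Qed.

Lemma path_adjE (i j : 'I_m) :
  path_adj i j = (j == i.+1 :> nat) || (i == j.+1 :> nat).
Proof. by []. Qed.

Lemma ord_eqE k (i j : 'I_k) : (i == j) = (i == j :> nat).
Proof. by []. Qed.

Lemma vert_clique x y : vert_adj x y -> clique G [set x; y].
Proof.
move=> xy; apply: clique_edge; [exact: grid_sym| |].
  by rewrite gridE xy orbT.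
case: x y xy => i j [k l]; rewrite /vert_adj /= => /andP[/eqP<- jl] [p q] /=.
rewrite /cart_prod /=; rewrite path_adjE !ord_eqE !cycle_adjE !path_adjE in jl *.
have := ltn_ord i; have := ltn_ord p; lia.
Qed.

Lemma grid_edge_clique x y : 3 < n -> G x y -> clique G [set x; y].
Proof.
move=> n_ge4 xy; apply: clique_edge => //; [exact: grid_sym|].
case: x y xy => i j [k l]; rewrite /cart_prod /= => xy [p q] /=.
rewrite !ord_eqE !cycle_adjE !path_adjE in xy *.
have := ltn_ord i; have := ltn_ord k; have := ltn_ord p; lia.
Qed.

End Grid.

(** * Cycles of length at least four *)

Section Rows.
Variables n m : nat.
Implicit Types S : {set 'I_n * 'I_m}.

(** The row index is any natural number, so rows beyond the last one count as empty and need no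
    separate case. *)
Definition row_card S r := #|[set x in S | x.2 == r :> nat]|.

Lemma sum_row_card S N : \sum_(r < N) row_card S r <= #|S|.
Proof.
have -> : \sum_(r < N) row_card S r = #|[set x in S | x.2 < N]|; last first.
  by apply/subset_leq_card/subsetP => x; rewrite inE => /andP[].
elim: N => [|N IH].
  by rewrite big_ord0; apply/esym/eq_card0 => x; rewrite inE andbF.
rewrite big_ord_recr /= {}IH -cardsUI [X in _ + X]eq_card0 ?addn0.
  by congr #|pred_of_set _|; apply/setP => x; rewrite !inE; case: (x \in S) => /=; lia.
by move=> x; rewrite !inE; lia.
Qed.

End Rows.

Section LongCycle.
Variables n m : nat.
Hypothesis n_ge3 : 2 < n.
Local Notation V := ('I_n * 'I_m)%type.
Local Notation G := (cart_prod (@cycle_adj n) (@path_adj m)).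
Implicit Types (x y z : V) (S : {set V}).

Let e_sym := @grid_sym n m.
Let e_irr := @grid_irr n m n_ge3.
Let noiso := @grid_no_isolated n m n_ge3.

Lemma grid_inhabited : 0 < m -> V.
Proof. by move=> m0; exact: (Ordinal (ltnW (ltnW n_ge3)), Ordinal m0). Qed.

Lemma alice_wins_max_degree first a : 0 < m -> 0 < a ->
  (forall r, r < m -> 2 + ((0 < r) + (r.+1 < m)) <= a) ->
  alice_wins_MCT G first a 1.
Proof.
move=> m0 a0 deg; have x0 := grid_inhabited m0.
have dega x : #|[set y | G x y]| <= a by rewrite card_grid_nbr // deg.
case: first; last exact: alice_degree_bob_start.
apply: (alice_degree_alice_start _ _ x0 _ _ (S := set0)); rewrite ?cards0 //.
by move=> x; apply: Or32.
Qed.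

Definition nat_cycle_adj i j :=
  [|| j == i.+1, i == j.+1, (i == 0) && (j.+1 == n) | (j == 0) && (i.+1 == n)].

Definition closed_nbr (x y : nat * nat) :=
  (x.1 == y.1) && [|| x.2 == y.2, y.2 == x.2.+1 | x.2 == y.2.+1] ||
  nat_cycle_adj x.1 y.1 && (x.2 == y.2).

(** The condition of [alice_degree_alice_start] on plain numbers, so that concrete openings are
    verified by evaluation. Cells outside the grid are ignored. *)
Definition good_opening a (s : seq (nat * nat)) :=
  all (fun i => all (fun r => let d := 2 + ((0 < r) + (r.+1 < m)) in
    (d <= a) || (d <= a.+1) &&
    has (fun y : nat * nat => [&& y.1 < n, y.2 < m & closed_nbr (i, r) y]) s)
    (iota 0 m)) (iota 0 n).

Definition cells (s : seq (nat * nat)) : {set V} :=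
  [set x : V | (x.1 : nat, x.2 : nat) \in s].

Lemma card_cells s : #|cells s| <= size s.
Proof.
pose f (x : V) := (x.1 : nat, x.2 : nat).
have f_inj : injective f by move=> [i r] [j q] [/ord_inj-> /ord_inj->].
rewrite cardE -(size_map f).
apply: uniq_leq_size => [|y]; first by rewrite map_inj_uniq ?enum_uniq.
by case/mapP=> x; rewrite mem_enum inE => xs ->.
Qed.

Lemma alice_wins_opening a s : 0 < m -> 0 < a -> size s <= a ->
  good_opening a s -> alice_wins_MCT G Alice a 1.
Proof.
move=> m0 a0 sa /allP H.
apply: (alice_degree_alice_start _ _ (grid_inhabited m0) _ _
  (S := cells s)) => //; first exact: leq_trans (card_cells s) sa.
move=> x; rewrite card_grid_nbr // inE.
have := H x.1; rewrite mem_iota ltn_ord => /(_ isT)/allP/(_ x.2).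
rewrite mem_iota ltn_ord => /(_ isT)/= /orP[?|/andP[dx /hasP[[j q] js /=]]].
  exact: Or32.
case/and3P=> jn qm; case: x dx => i r /= dx; rewrite /closed_nbr /=.
have [/eqP Ex _|ne adj] := boolP ((i : nat, r : nat) == (j, q)).
  by apply: Or31; rewrite /= Ex.
apply: Or33; split=> //; exists (Ordinal jn, Ordinal qm); rewrite ?inE //.
rewrite /cart_prod /= cycle_adjE path_adjE !ord_eqE /=.
by move: ne adj; rewrite xpair_eqE /nat_cycle_adj; lia.
Qed.

Lemma card_cols S (P : pred 'I_m) :
  #|[set x.1 | x in S & P x.2]| <= #|[set x in S | P x.2]|.
Proof.
apply: leq_trans (leq_imset_card fst _) _; apply: subset_leq_card.
by apply/subsetP => x; rewrite !inE.
Qed.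

Lemma row_undominated S r (rm : r < m) :
  3 * row_card S r + (if r is q.+1 then row_card S q else 0) + row_card S r.+1 < n ->
  exists i : 'I_n, let x := (i, Ordinal rm) in
    x \notin S /\ forall y, y \in S -> ~~ G x y.
Proof.
pose C q := [set x.1 | x in S & x.2 == q :> nat].
have cardC q : #|C q| <= row_card S q.
  exact: (card_cols S (fun j => j == q :> nat)).
pose C' := if r is q.+1 then C q else set0.
(* [D] collects the columns dominated in row [r]: those of the vertices of [S] in that row, their
   two shifts around the cycle, and those of [S] in the adjacent rows. *)
pose D := C r :|: (@ordS n @: C r) :|: (@ord_pred n @: C r) :|: C' :|: C r.+1.
move=> lt_n; have : D != setT.
  apply: contraTneq lt_n => /(congr1 (fun A : {set 'I_n} => #|A|)).
  rewrite cardsT card_ord => cardD; rewrite -leqNgt.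
  apply: (@leq_trans #|D|); first by rewrite cardD.
  have leU (A B : {set 'I_n}) a b : #|A| <= a -> #|B| <= b -> #|A :|: B| <= a + b.
    by move=> Aa Bb; apply: leq_trans (leq_card_setU _ _) (leq_add Aa Bb).
  rewrite (_ : 3 * _ = row_card S r + row_card S r + row_card S r); last by lia.
  have leI f : #|[set f i | i in C r] : {set 'I_n}| <= row_card S r.
    exact: leq_trans (leq_imset_card _ _) (cardC _).
  apply: (leU _ _ _ _ _ (cardC _)); apply: (leU); last first.
    by rewrite /C'; case: (r) => [|q]; rewrite ?cards0.
  exact: leU (leU _ _ _ _ (cardC _) (leI _)) (leI _).
rewrite -subTset => /subsetPn[i _]; rewrite /D !in_setU !negb_or.
rewrite -!andbA => /and5P[nC nS nP nC' nC1].
have inC y : y \in S -> y.1 \in C y.2.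
  by move=> yS; apply/imsetP; exists y; rewrite // inE yS eqxx.
exists i; split=> [|y yS].
  apply: contra nC => xS; apply/imsetP; exists (i, Ordinal rm) => //.
  by rewrite inE xS /= eqxx.
apply/negP; rewrite /cart_prod /= => /orP[/andP[/orP[/eqP yi|/eqP iy] /eqP ry]|].
- case/imsetP: nP; exists y.1; last by rewrite yi ordSK.
  by rewrite -[r]/(val (Ordinal rm)) ry; apply: inC.
- case/imsetP: nS; exists y.1 => //.
  by rewrite -[r]/(val (Ordinal rm)) ry; apply: inC.
case/andP=> /eqP Ei; rewrite Ei in nC' nC1.
rewrite path_adjE /= => /orP[/eqP yr|/eqP ry].
  by rewrite -yr inC in nC1.
by move: nC'; rewrite /C' ry inC.
Qed.

Lemma bob_wins_row S a r : 3 < n -> r < m -> a < 2 + ((0 < r) + (r.+1 < m)) ->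
  3 * row_card S r + (if r is q.+1 then row_card S q else 0) + row_card S r.+1 < n ->
  bob_win G a 2 (S, set0).
Proof.
move=> n4 rm ar /(row_undominated rm)[i [xS nS]].
apply: (bob_win_undominated e_irr) xS nS _; last by rewrite card_grid_nbr.
by move=> u v; apply: grid_edge_clique.
Qed.

Lemma bob_start_lost_row a r : 3 < n -> 0 < a -> r < m ->
  a < 2 + ((0 < r) + (r.+1 < m)) -> ~ alice_wins_MCT G Bob a 1.
Proof.
move=> n4 a0 rm ar; apply: (bob_start_lost (N := 2)) => //.
have k0 q : row_card set0 q = 0 by apply: eq_card0 => x; rewrite !inE.
by apply: (bob_wins_row n4 rm ar); rewrite !k0; case: (r) => [|?]; rewrite ?k0; lia.
Qed.

End LongCycle.

(** * Triangles *)

Section Triangle.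
Variable m : nat.
Local Notation V := ('I_3 * 'I_m)%type.
Local Notation G := (cart_prod (@cycle_adj 3) (@path_adj m)).
Implicit Types (v w x y z : V) (A S : {set V}) (p : position V) (c : 'I_3) (r : 'I_m).

Lemma triangleE c c' : cycle_adj c c' = (c != c').
Proof. by rewrite cycle_adjE ord_eqE; have := ltn_ord c; have := ltn_ord c'; lia. Qed.

Lemma vert_adj_irr x : vert_adj x x = false.
Proof. by rewrite /vert_adj /= path_adj_irr andbF. Qed.

Lemma other_columns c : exists c1 c2,
  [/\ c1 != c, c2 != c & c1 != c2] /\ [set~ c] = [set c1; c2].
Proof.
have /eqP/cards2P[c1 [c2 [c12 E]]] : #|[set~ c]| = 2 by rewrite cardsC1 card_ord.
exists c1, c2; rewrite E; split=> //; split=> //.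
  by have := set21 c1 c2; rewrite -E !inE.
by have := set22 c1 c2; rewrite -E !inE.
Qed.

Definition row r := [set x : V | x.2 == r].

(** A vertex outside the row is not adjacent to the vertices of the row in other columns, so the
    triangle is maximal. *)
Lemma row_clique r : clique G (row r).
Proof.
apply: clique_intro => [|z]; last first.
  rewrite inE => zr; have [c1 [_ [[c1z _ _] _]]] := other_columns z.1.
  exists (c1, r); rewrite ?inE //= /cart_prod /=.
  by rewrite (eq_sym r) (negPf zr) (negPf c1z) andbF.
apply/forall_inP => -[c i]; rewrite inE /= => /eqP->.
apply/forall_inP => -[c' j]; rewrite inE /= => /eqP->; apply/implyP.
by rewrite xpair_eqE eqxx andbT /cart_prod /= triangleE eqxx => ->.
Qed.

(** A clique that meets two rows contains a path edge; otherwise it lies in one row and equals it by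
    maximality. *)
Lemma triangle_cliqueP K : 0 < m -> clique G K ->
  (exists x y, [/\ x \in K, y \in K & vert_adj x y]) \/ exists r, K = row r.
Proof.
move=> m0 cK; have x0 : V := (ord0, Ordinal m0).
have [x [y [xK yK xy]]] :=
  clique_has_edge (@grid_sym 3 m) x0 (@grid_no_isolated 3 m isT) cK.
have /maxsetP[/forall_inP complK maxK] := cK.
have [/existsP[z /andP[zK zx]]|] := boolP [exists z in K, z.2 != x.2].
  left; exists x, z; split=> //.
  have /forall_inP/(_ z zK)/implyP := complK x xK.
  rewrite gridE [x.2 == _]eq_sym (negPf zx) andbF; apply.
  by apply: contraNneq zx => ->.
rewrite negb_exists => /forallP sub; right; exists x.2.
apply/esym/maxK; first by have /maxsetP[] := row_clique x.2.
by apply/subsetP => z zK; have := sub z; rewrite zK inE negbK.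
Qed.

Lemma mem_row x : x \in row x.2. Proof. by rewrite inE. Qed.

(** * Alice's strategy on triangles *)

Section Alice.
Variable a : nat.
Hypothesis a_ge2 : 1 < a.

(** With [S] the red set, these are the vertices Alice has to color once Bob takes [x]. *)
Let threats S x := [set y | vert_adj x y & y \notin S].

Lemma card_threats S x : #|threats S x| <= (0 < x.2) + (x.2.+1 < m).
Proof.
by rewrite -card_vert_nbr; apply/subset_leq_card/subsetP => y; rewrite !inE => /andP[].
Qed.

Let threats_le S x : #|threats S x| <= a.
Proof.
apply: leq_trans (card_threats S x) (leq_trans _ a_ge2).
exact: leq_add (leq_b1 _) (leq_b1 _).
Qed.

Let threats_mono S S' x : S \subset S' -> #|threats S' x| <= #|threats S x|.
Proof.
move=> /subsetP sS; apply/subset_leq_card/subsetP => y; rewrite !inE.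
by case/andP=> -> yS'; apply: contra yS'; apply: sS.
Qed.

Let row_ok p r := [exists x in p.1, x \in row r] ||
  [exists c, [forall c', (c' != c) ==>
    ((c', r) \in unplayed p) && (#|threats p.1 (c', r)| < a)]].

Let row_ok_red p x : x \in p.1 -> row_ok p x.2.
Proof. by move=> xR; apply/orP; left; apply/existsP; exists x; rewrite xR mem_row. Qed.

Let row_ok_intro p r c :
  (forall c', c' != c -> (c', r) \notin p.2 /\ #|threats p.1 (c', r)| < a) ->
  row_ok p r.
Proof.
move=> H; rewrite /row_ok; case: (boolP [exists x in p.1, x \in row r]) => //.
rewrite negb_exists => /forallP nR; apply/existsP; exists c.
apply/forallP => c'; apply/implyP => /H[nB ->]; rewrite in_unplayed nB !andbT.
by have := nR (c', r); rewrite inE eqxx andbT.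
Qed.

Let row_okP p r : row_ok p r -> (exists2 x, x \in p.1 & x.2 = r) \/
  exists c, forall c', c' != c ->
    (c', r) \in unplayed p /\ #|threats p.1 (c', r)| < a.
Proof.
case/orP=> [/existsP[x /andP[xR]]|/existsP[c /forallP H]].
  by rewrite inE => /eqP; left; exists x.
by right; exists c => c' ne; have := H c'; rewrite ne => /andP[].
Qed.

(* A row without red may lose one column [c] for good: on the two remaining ones
   Alice still has a spare move that puts red into the row. *)
Let J : pred (position V) := fun p =>
  [forall x in p.2, forall y, vert_adj x y ==> (y \in p.1)] &&
  [forall r, row_ok p r].

Let JP p : reflect ((forall x y, x \in p.2 -> vert_adj x y -> y \in p.1) /\
  forall r, row_ok p r) (J p).
Proof.
apply: (iffP andP) => -[H1 H2]; split.
- by move=> x y xB xy; have /forall_inP/(_ x xB)/forallP/(_ y)/implyP := H1; apply.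
- exact/forallP.
- by apply/forall_inP => x xB; apply/forallP => y; apply/implyP; apply: H1.
- exact/forallP.
Qed.

Let J_mono p A : J p -> A \subset unplayed p -> J (p.1 :|: A, p.2).
Proof.
case/JP=> HB Hrow _; apply/JP; split=> [x y xB xy|r].
  by rewrite inE (HB x).
have [[x xR <-]|[c Hc]] := row_okP (Hrow r); first by apply: row_ok_red; rewrite inE xR.
apply: (row_ok_intro (c := c)) => c' /Hc[U lt]; split.
  by move: U; rewrite in_unplayed => /andP[].
exact: leq_ltn_trans (threats_mono _ (subsetUl _ _)) lt.
Qed.

Let J_end p : 0 < m -> J p -> unplayed p = set0 -> alice_won G p.
Proof.
move=> m0 /JP[HB Hrow] U0 K /(triangle_cliqueP m0)[[x [y [xK yK xy]]]|[r ->]].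
  have /setP/(_ x) := U0; rewrite in_unplayed inE => /negbT.
  rewrite negb_and !negbK => /orP[xR|xB]; first by exists x.
  by exists y => //; apply: HB xy.
have [[x xR <-]|[c Hc]] := row_okP (Hrow r); first by exists x; rewrite ?mem_row.
have [c1 [_ [[c1c _ _] _]]] := other_columns c.
by have [] := Hc c1 c1c; rewrite U0 inE.
Qed.

Let J_step p v : J p -> v \in unplayed p -> exists A,
  [/\ A \subset unplayed (p.1, p.2 :|: [set v]), #|A| <= a
    & J (p.1 :|: A, p.2 :|: [set v])].
Proof.
case/JP=> HB Hrow; rewrite in_unplayed => /andP[vR vB].
(* A blue path neighbour of [v] would have forced [v] to be red, so all threats are unplayed. *)
have subT : threats p.1 v \subset unplayed (p.1, p.2 :|: [set v]).
  apply/subsetP => y; rewrite !inE => /andP[vy yR]; rewrite (negPf yR) /=.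
  rewrite negb_or; apply/andP; split.
    by apply: contra vR => yB; apply: HB yB _; rewrite vert_adj_sym.
  by apply: contraTneq vy => ->; rewrite vert_adj_irr.
(* Only the row of [v] needs a check: other rows lose no vertex to Bob, and their threats can only
   shrink. *)
have suff_row A : threats p.1 v \subset A ->
    row_ok (p.1 :|: A, p.2 :|: [set v]) v.2 -> J (p.1 :|: A, p.2 :|: [set v]).
  move=> /subsetP sA ok; apply/JP; split=> [x y|r].
    rewrite !inE => /orP[xB xy|/eqP-> vy]; first by rewrite (HB x).
    by case: (boolP (y \in p.1)) => //= yR; apply: sA; rewrite inE vy.
  have [<- //|vr] := eqVneq v.2 r.
  have [[x xR <-]|[c Hc]] := row_okP (Hrow r).
    by apply: row_ok_red; rewrite inE xR.
  apply: (row_ok_intro (c := c)) => c' /Hc[U lt]; split.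
    move: U; rewrite in_unplayed !inE => /andP[_ /negPf->] /=.
    by apply: contraNneq vr => <-.
  exact: leq_ltn_trans (threats_mono _ (subsetUl _ _)) lt.
have subU A : p.1 \subset p.1 :|: A := subsetUl _ _.
have [[x xR xv]|[c Hc]] := row_okP (Hrow v.2).
  exists (threats p.1 v); split=> //.
  by apply: suff_row => //; rewrite -xv; apply: row_ok_red; rewrite inE xR.
(* If Bob takes the expendable column [c], the two others remain as they were. *)
have [cv|cv] := eqVneq v.1 c.
  exists (threats p.1 v); split=> //.
  apply: suff_row => //; apply: (row_ok_intro (c := c)) => c' ne.
  have [U lt] := Hc c' ne; split;
    last exact: leq_ltn_trans (threats_mono _ (subU _)) lt.
  move: U; rewrite in_unplayed !inE => /andP[_ /negPf->] /=.
  by apply: contraNneq ne => E; rewrite -cv -E.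
(* Otherwise [v] has fewer than [a] threats, and the spare vertex goes to the third column, which
   puts red into the row. *)
have [c' c'c c'v] : exists2 c', c' != c & c' != v.1.
  have [c1 [c2 [[c1c c2c c12] _]]] := other_columns c.
  have [E|] := eqVneq c1 v.1; last by exists c1.
  by exists c2; rewrite // -E eq_sym.
have [wU _] := Hc c' c'c; exists ((c', v.2) |: threats p.1 v); split.
- rewrite subUset subT andbT sub1set; move: wU; rewrite !in_unplayed !inE.
  case/andP=> -> /negPf-> /=; apply: contraNneq c'v => <- //.
- rewrite cardsU1; have [_] := Hc _ cv; rewrite -surjective_pairing.
  by apply: leq_trans; rewrite -[X in _ <= X]add1n leq_add2r leq_b1.
- apply: suff_row; first exact: subsetUr.
  by rewrite -[v.2]/((c', v.2) : V).2; apply: row_ok_red; rewrite !inE eqxx orbT.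
Qed.

Let J_start S : (forall r, (exists2 x, x \in S & x.2 = r) \/
  exists c, forall c', c' != c -> #|threats S (c', r)| < a) -> J (S, set0).
Proof.
move=> H; apply/JP; split=> [x y|r]; first by rewrite inE.
have [[x xS <-]|[c Hc]] := H r; first exact: row_ok_red.
by apply: (row_ok_intro (c := c)) => c' /Hc; rewrite inE.
Qed.

Lemma alice_wins_triangle first : 0 < m ->
  (forall r : nat, r < m -> (0 < r) + (r.+1 < m) < a) ->
  alice_wins_MCT G first a 1.
Proof.
move=> m0 deg; have J0 : J (set0, set0).
  apply: J_start => r; right; exists ord0 => c' _.
  by apply: leq_ltn_trans (card_threats _ _) _; apply: deg.
have a0 := ltnW a_ge2; case: first.
  apply: (alice_wins_alice_start J_step J_mono) J0 => //; last by rewrite cards0.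
  by move=> p; apply: J_end.
apply: (alice_wins_bob_start J_step J_mono) J0 => // p.
exact: J_end.
Qed.

Lemma alice_wins_triangle_short : 1 < m <= 5 -> alice_wins_MCT G Alice a 1.
Proof.
case/andP=> m2 m5; have m0 := ltnW m2.
(* Rows 1 and 3 become red; in row 2 only column 2 keeps two uncolored path
   neighbours. Cells outside the grid are ignored. *)
pose S := cells 3 m [:: (0, 1); (1, 3)].
apply: (alice_wins_alice_start J_step J_mono _ (S := S)).
- by move=> p; apply: J_end.
- exact: ltnW.
- exact: leq_trans (card_cells 3 m [:: (0, 1); (1, 3)]) a_ge2.
apply: J_start => r.
have inS c i : ((c, i) \in S) =
    (c == 0 :> nat) && (i == 1 :> nat) || (c == 1 :> nat) && (i == 3 :> nat).
  by rewrite !inE /= !xpair_eqE.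
have [r1|r1] := eqVneq (r : nat) 1.
  by left; exists (ord0, r); rewrite // inS r1.
have [r3|r3] := eqVneq (r : nat) 3.
  by left; exists (Ordinal (isT : 1 < 3), r); rewrite // inS r3.
right; have [r2|r2] := eqVneq (r : nat) 2; last first.
  (* Only rows 0 and 4 are left. Both are end rows, as m is at most 5, and have one path neighbour
     per column. *)
  exists ord0 => c' _; apply: leq_ltn_trans (card_threats _ _) _ => /=.
  by have := ltn_ord r; lia.
exists ord_max => c ne; apply: leq_trans _ a_ge2.
(* For m = 3 row 2 is an end row; otherwise columns 0 and 1 each have a red path neighbour, below
   and above respectively. *)
have [m3|m3] := leqP m 3.
  by apply: leq_ltn_trans (card_threats _ _) _ => /=; lia.
have [y yS vy] : exists2 y, y \in S & vert_adj (c, r) y.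
  have [c0|c0] := eqVneq (c : nat) 0.
    by exists (c, Ordinal m2); rewrite ?inS ?c0 // /vert_adj /= eqxx path_adjE /= r2.
  exists (c, Ordinal m3); last by rewrite /vert_adj /= eqxx path_adjE /= r2.
  by rewrite inS /=; move: ne; rewrite ord_eqE /=; have := ltn_ord c; lia.
have := card_vert_nbr (c, r).
have : #|threats S (c, r)| < #|[set y | vert_adj (c, r) y]|.
  apply: proper_card; rewrite properE; apply/andP; split.
    by apply/subsetP => z; rewrite !inE => /andP[].
  by apply/subsetPn; exists y; rewrite inE ?yS ?andbF.
by move=> /= lt E; move: lt; rewrite E; lia.
Qed.

End Alice.

(** * Bob's attack on a row of a triangle grid *)

Lemma bob_win_triangle a S r : (forall x, x \in S -> x.2 != r) ->
  #|[set x in S | path_adj r x.2]| <= 1 -> a <= (0 < r) + (r.+1 < m) ->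
  bob_win G a 3 (S, set0).
Proof.
move=> Sr S1 ar.
(* [c3] is the column of the only possible red vertex in the adjacent rows, or arbitrary if there is
   none. *)
have [c3 Hc3] : exists c3, forall x, x \in S -> path_adj r x.2 -> x.1 = c3.
  have [E0|/set0Pn[x0 x0S]] := eqVneq [set x in S | path_adj r x.2] set0.
    exists ord0 => x xS rx; have /setP/(_ x) := E0.
    by rewrite !inE xS rx.
  exists x0.1 => x xS rx; congr fst.
  by have /card_le1_eqP eqS := S1; apply: eqS; rewrite // inE xS.
have [c1 [c2 [[c13 c23 c12] E12]]] := other_columns c3.
pose D c := [set y | vert_adj (c, r) y].
have cardD c : #|D c| = (0 < r) + (r.+1 < m) by exact: card_vert_nbr.
have DS c y : c != c3 -> y \in D c -> y \notin S.
  rewrite inE => cc3 /andP[/eqP /= cy ry]; apply: contra cc3 => yS.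
  by rewrite cy (Hc3 y).
have nS c : (c, r) \notin S by apply/negP => /Sr; rewrite eqxx.
have Drow c c' : (c', r) \notin D c.
  by rewrite inE /vert_adj /= path_adj_irr andbF.
apply: (@bob_win_step _ _ _ _ _ (c1, r)); first by rewrite in_unplayed nS inE.
move=> A sAU Aa; rewrite [(_, _).1]/= [(_, _).2]/= set0U.
have [sDA|/subsetPn[y yD yA]] := boolP (D c1 \subset A); last first.
  apply: (@bob_win_now _ _ _ _ _ y [set (c1, r); y]); rewrite ?subxx //.
    rewrite in_unplayed !inE negb_or yA (DS c1) //=.
    by apply: contraTneq yD => ->; apply: Drow.
  by apply: vert_clique; move: yD; rewrite inE.
(* Alice's whole turn went into the path neighbours of [c1], so the fork at [c2] has at least a + 1
   prongs, one of them completing the row. *)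
have EA : A = D c1 by apply/esym/eqP; rewrite eqEcard sDA cardD (leq_trans Aa).
rewrite EA; apply: (@bob_win_fork _ _ _ _ (c2, r) ((c3, r) |: D c2)).
- by rewrite in_unplayed !in_setU in_set1 negb_or nS Drow xpair_eqE eq_sym (negPf c12).
- apply/subsetP => y /setU1P[->|yD];
    rewrite in_setD1 in_unplayed !in_setU in_set1 negb_or.
    by rewrite nS Drow !xpair_eqE eq_sym (negPf c23) eq_sym (negPf c13).
  rewrite (DS c2) //=; move: yD; rewrite !inE /vert_adj /= => /andP[/eqP<- ry].
  have yr : y.2 != r by apply: contraTneq ry => ->; rewrite path_adj_irr.
  by case: y yr {ry} => i j /= yr; rewrite !xpair_eqE (negPf yr) (negPf c12) !andbF.
- by rewrite cardsU1 Drow cardD add1n ltnS.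
move=> w /setU1P[->|wD]; last first.
  exists [set (c2, r); w]; last exact: subsetUr.
  by apply: vert_clique; move: wD; rewrite inE.
exists (row r); first exact: row_clique.
apply/subsetP => -[c i]; rewrite !inE !xpair_eqE /= => /eqP->; rewrite eqxx !andbT.
by have /setP/(_ c) := E12; rewrite !inE orbA => <-; rewrite orNb.
Qed.

Lemma bob_start_lost_triangle a r : 0 < a -> a <= (0 < r) + (r.+1 < m) ->
  ~ alice_wins_MCT G Bob a 1.
Proof.
move=> a0 ar; apply: (bob_start_lost (N := 3)) => //.
apply: (bob_win_triangle _ _ ar) => [x|]; first by rewrite inE.
by rewrite eq_card0 // => x; rewrite !inE.
Qed.

Lemma bob_win_triangle_row a S i : i < m -> row_card S i = 0 ->
  (if i is j.+1 then row_card S j else 0) + row_card S i.+1 <= 1 ->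
  a <= (0 < i) + (i.+1 < m) -> bob_win G a 3 (S, set0).
Proof.
move=> im k0 k1 ai; apply: (@bob_win_triangle a S (Ordinal im)) => //.
  move=> x xS; apply/eqP => Ex; suff : 0 < row_card S i by rewrite k0.
  by apply/card_gt0P; exists x; rewrite inE xS Ex /=.
apply: leq_trans k1; pose Lo := [set x in S | i == x.2.+1 :> nat].
have loE : #|Lo| = if i is j.+1 then row_card S j else 0.
  case: i @Lo {im k0 ai} => [|j] Lo; first by apply: eq_card0 => x; rewrite inE andbF.
  by apply: eq_card => x; rewrite !inE eqSS eq_sym.
rewrite -loE addnC; apply: leq_trans (leq_card_setU _ _).
by apply/subset_leq_card/subsetP => x; rewrite !inE path_adjE -andb_orr.
Qed.

End Triangle.

(** * Thresholds *)

Section Thresholds.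
Variables n m : nat.
Hypotheses (n_ge3 : 2 < n) (m_ge2 : 1 < m).
Local Notation V := ('I_n * 'I_m)%type.
Local Notation G := (cart_prod (@cycle_adj n) (@path_adj m)).
Implicit Types (S : {set V}).

Let m_gt0 : 0 < m := ltnW m_ge2.

Lemma threshold_intro first t : 0 < t -> alice_wins_MCT G first t 1 ->
  (forall a, 0 < a -> a < t -> ~ alice_wins_MCT G first a 1) ->
  is_threshold G first t.
Proof.
move=> t0 win lose; split=> // a a0 wa; rewrite leqNgt; apply/negP => at_.
exact: lose wa.
Qed.

(** Six rows suffice below: the last row tested is row 4, and its upper neighbour is row 5. *)
Lemma sum_row_card6 S a : #|S| <= a ->
  row_card S 0 + row_card S 1 + row_card S 2 + row_card S 3 + row_card S 4
  + row_card S 5 <= a.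
Proof.
by move=> Sa; have := leq_trans (sum_row_card S 6) Sa; rewrite !big_ord_recr big_ord0.
Qed.

Lemma alice_start_lost_rows a rows : 3 < n -> 0 < a ->
  all (fun r => (r < m) && (a < 2 + ((0 < r) + (r.+1 < m)))) rows ->
  (forall S, #|S| <= a -> has (fun r =>
    3 * row_card S r + (if r is q.+1 then row_card S q else 0)
    + row_card S r.+1 < n) rows) ->
  ~ alice_wins_MCT G Alice a 1.
Proof.
move=> n4 a0 /allP deg H; apply: (alice_start_lost (N := 2)) => // S /H/hasP[r rR lt].
by have /andP[rm ar] := deg r rR; apply: (bob_wins_row n_ge3 n4 rm ar).
Qed.

(** The rows tested are inner ones, with degree 4. Three red vertices dominate at most 9 columns of
    a single row. For m >= 6 the four inequalities add up to 16 <= 15. For m = 4 and m = 5 the sum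
    allows at most equality, which a single inequality then refutes. *)
Lemma alice_start_lost4 a : 0 < a -> a < 4 ->
  [|| (9 < n) && (m == 3), (5 < n) && (m == 4), (4 < n) && (m == 5)
    | (3 < n) && (5 < m)] ->
  ~ alice_wins_MCT G Alice a 1.
Proof.
move=> a0 a4 H.
apply: (@alice_start_lost_rows _ [seq r <- [:: 1; 2; 3; 4] | r.+1 < m]) => //.
- lia.
- by apply/allP => r; rewrite mem_filter !inE; lia.
move=> S Sa; have := sum_row_card6 Sa; apply: contraLR => Hr.
have {}Hr r : r \in [:: 1; 2; 3; 4] -> r.+1 < m ->
    n <= 3 * row_card S r + (if r is q.+1 then row_card S q else 0) + row_card S r.+1.
  by move=> rI rm; rewrite leqNgt; apply: (hasPn Hr); rewrite mem_filter rm.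
have := Hr 1 isT; have := Hr 2 isT; have := Hr 3 isT; have := Hr 4 isT.
move=> /= {Hr}; lia.
Qed.

(** For m >= 3, dominating row 0 takes both red vertices, at least one in row 0 and the rest in rows
    0 and 1; row 2 is then out of reach. For m = 2 the two inequalities add up to at least 10, but
    two red vertices supply at most 8. *)
Lemma alice_start_lost3 a : 0 < a -> a < 3 -> (4 < n) || (3 < n) && (2 < m) ->
  ~ alice_wins_MCT G Alice a 1.
Proof.
move=> a0 a3 H.
apply: (@alice_start_lost_rows _ [seq r <- [:: 0; 1; 2] | r < m]) => //.
- lia.
- by apply/allP => r; rewrite mem_filter !inE; lia.
move=> S Sa; have := sum_row_card6 Sa; apply: contraLR => Hr.
have {}Hr r : r \in [:: 0; 1; 2] -> r < m ->
    n <= 3 * row_card S r + (if r is q.+1 then row_card S q else 0) + row_card S r.+1.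
  by move=> rI rm; rewrite leqNgt; apply: (hasPn Hr); rewrite mem_filter rm.
have := Hr 0 isT; have := Hr 1 isT; have := Hr 2 isT.
move=> /= {Hr}; lia.
Qed.

Lemma alice_start_lost1 : 3 < n -> ~ alice_wins_MCT G Alice 1 1.
Proof.
move=> n4; apply: (@alice_start_lost_rows _ [:: 0; 1]) => //=; first lia.
by move=> S Sa; have := sum_row_card6 Sa; apply: contraLR => /=; lia.
Qed.

Lemma bob_start_threshold : 3 < n -> is_a1' G (if m == 2 then 3 else 4).
Proof.
move=> n4; apply: threshold_intro; first by case: ifP.
  apply: alice_wins_max_degree => //; first by case: ifP.
  by move=> r; case: ifP; lia.
move=> a a0 am.
(* The boolean serves as row index: 0 if [m = 2] and 1 otherwise. *)
apply: (@bob_start_lost_row _ _ n_ge3 _ (m != 2)) => //.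
  by case: eqP => /=; lia.
by move: am; case: eqP => [->|] //=; lia.
Qed.

End Thresholds.

Lemma alice_start_threshold n m : 3 < n -> 1 < m ->
  is_a1 (cart_prod (@cycle_adj n) (@path_adj m))
    (if (n == 4) && (m == 2) then 2
     else if [|| (n == 4) && (m <= 5), (n == 5) && (m <= 4),
                 (n <= 9) && (m <= 3) | m == 2] then 3
     else 4).
Proof.
move=> n4 m2; have n3 := ltnW n4; have m0 := ltnW m2.
case: ifP => [/andP[/eqP En /eqP Em]|nQ3].
  apply: threshold_intro => //.
    (* Two antipodal vertices of the cube dominate it. *)
    by apply: (@alice_wins_opening n m n3 2 [:: (0, 0); (2, 1)]) => //; rewrite En Em.
  move=> a a0 a2; have -> : a = 1 by lia.
  exact: alice_start_lost1.
case: ifP => [small|large]; apply: threshold_intro => //.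
- have [Em|m3] := eqVneq m 2.
    by apply: alice_wins_max_degree => // r; rewrite Em; lia.
  have [s s3 ops] : exists2 s, size s <= 3 & good_opening n m 3 s.
    have [En|n_ne4] := eqVneq n 4.
      (* Only inner rows have to be dominated. The red vertices alternate between opposite columns,
         each covering the column missed in the row next to it. *)
      exists [:: (0, 1); (2, 2); (0, 3)] => //; rewrite En.
      by have /or3P[/eqP->|/eqP->|/eqP->] : [|| m == 3, m == 4 | m == 5] by lia.
    have [En|n_ne5] := eqVneq n 5.
      (* In row 1, (0,1) covers columns 4, 0, 1 and the other two vertices cover 2 and 3; in row 2
         they cover all but column 0, which (0,1) covers. *)
      exists [:: (0, 1); (2, 2); (3, 2)] => //; rewrite En.
      by have /orP[/eqP->|/eqP->] : (m == 3) || (m == 4) by lia.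
    (* Three blocks of three columns cover row 1; the minimum keeps the last vertex inside the
       cycle. *)
    exists [:: (1, 1); (4, 1); (minn 7 n.-1, 1)] => //.
    have -> : m = 3 by lia.
    by have /or4P[/eqP->|/eqP->|/eqP->|/eqP->] :
      [|| n == 6, n == 7, n == 8 | n == 9] by lia.
  exact: alice_wins_opening ops.
- by move=> a a0 a3; apply: alice_start_lost3 => //; lia.
- by apply: alice_wins_max_degree => // r; lia.
by move=> a a0 a4; apply: alice_start_lost4 => //; lia.
Qed.

Lemma triangle_alice_start_threshold m : 1 < m ->
  is_a1 (cart_prod (@cycle_adj 3) (@path_adj m)) (if m <= 5 then 2 else 3).
Proof.
move=> m2; have m0 := ltnW m2; case: leqP => m5; apply: threshold_intro => //.
- by apply: alice_wins_triangle_short; rewrite ?m2.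
- move=> a a0 a2; apply: (alice_start_lost (N := 3)) => // S Sa.
  (* There is at most one red vertex. Bob attacks row 0 unless it lies there, and row 1
     otherwise. *)
  have k6 := sum_row_card6 Sa; have [k0|k0] := eqVneq (row_card S 0) 0.
    by apply: (bob_win_triangle_row (i := 0)) => //; lia.
  by apply: (bob_win_triangle_row (i := 1)) => //; lia.
- by apply: alice_wins_triangle => // r; lia.
move=> a a0 a3; apply: (alice_start_lost (N := 3)) => // S Sa.
have k6 := sum_row_card6 Sa.
(* Two red vertices protect at most three rows, their own and those having both of them in adjacent
   rows, so one of four inner rows is open to attack. *)
pose ok i := (row_card S i == 0) && (row_card S i.-1 + row_card S i.+1 <= 1).
have : has ok [:: 1; 2; 3; 4] by rewrite /= /ok /=; lia.
case/hasP=> i; rewrite !inE => i4 /andP[/eqP ki ki1].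
apply: (bob_win_triangle_row (i := i)) => //; [lia| |lia].
by case: i i4 ki1 {ki}.
Qed.

Lemma triangle_bob_start_threshold m : 1 < m ->
  is_a1' (cart_prod (@cycle_adj 3) (@path_adj m)) (if m == 2 then 2 else 3).
Proof.
move=> m2; have m0 := ltnW m2; apply: threshold_intro; first by case: ifP.
  apply: alice_wins_triangle => //; first by case: ifP.
  by move=> r; case: eqP => /=; lia.
move=> a a0 am; have im : (m != 2) < m by case: eqP => /=; lia.
apply: (@bob_start_lost_triangle _ _ (Ordinal im)) => //=.
by move: am; case: eqP => [->|] /=; lia.
Qed.

Theorem theorem4p2 (n m : nat) (hn : 3 <= n) (hm : 2 <= m) :
  is_a1 (cart_prod (@cycle_adj n) (@path_adj m))
    (if ((n == 3) && (2 <= m <= 5)) || ((n == 4) && (m == 2)) then 2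
     else if [|| (n == 3) && (6 <= m),
                 (n == 4) && (3 <= m <= 5),
                 (n == 5) && (2 <= m <= 4),
                 (6 <= n <= 9) && ((m == 2) || (m == 3))
               | (10 <= n) && (m == 2)] then 3
     else 4)
  /\
  is_a1' (cart_prod (@cycle_adj n) (@path_adj m))
    (if (n == 3) && (m == 2) then 2
     else if ((n == 3) && (3 <= m)) || ((4 <= n) && (m == 2)) then 3
     else 4).
Proof.
have [n3|n_ne3] := eqVneq n 3.
  rewrite {}n3 in hn *; split.
    have := triangle_alice_start_threshold hm; congr is_a1.
    by do ?[case: ifP => /=]; lia.
  have := triangle_bob_start_threshold hm; congr is_a1'.
  by do ?[case: ifP => /=]; lia.
have n4 : 3 < n by lia.
split.
  have := alice_start_threshold n4 hm; congr is_a1.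
  by do ?[case: ifP => /=]; lia.
have := bob_start_threshold hn hm n4; congr is_a1'.
by do ?[case: ifP => /=]; lia.
Qed.
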